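(* Let $1<\alpha\le2$, let $K_1,K_2\ge0$ with $K_1^2+K_2^2\ne0$, and let $c_{-1},c_0,c_1,d_{-1},d_0,d_1$ be real coefficients of a quasi-compact approximation, with associated matrices $\mathbf{T}$ and $\mathbf{A}$ as in the context. If $\mathbf{T}$ is symmetric and positive definite and $\mathbf{A}$ is negative definite, then the CN-quasi-compact scheme $$\left(\mathbf{T}-\frac{\tau}{2h^{\alpha}}(K_1\mathbf{A}+K_2\mathbf{A}^{T})\right)\mathbf{U}^{n+1}=\left(\mathbf{T}+\frac{\tau}{2h^{\alpha}}(K_1\mathbf{A}+K_2\mathbf{A}^{T})\right)\mathbf{U}^{n}+\tau\mathbf{F}^{n}+\mathbf{H}^{n}$$ is unconditionally stable.
   Context: The scheme discretizes $\partial_tu=K_1\,{}_{x_L}D_x^{\alpha}u+K_2\,{}_xD_{x_R}^{\alpha}u+f$ on $(x_L,x_R)\times(0,T)$ (left and right Riemann-Liouville derivatives) with an initial condition and Dirichlet boundary conditions, using space step $h=(x_R-x_L)/N$, time step $\tau=T/M$, and $\mathbf{U}^n=(U_1^n,\dots,U_{N-1}^n)^T$, where $U_i^n$ approximates $u(x_i,t_n)$. The vectors $\mathbf{F}^n$ and $\mathbf{H}^n$ contain the source term and the boundary data and do not affect the iteration matrix. The matrices are of size $(N-1)\times(N-1)$: $\mathbf{T}$ is the tridiagonal Toeplitz matrix with $c_0$ on the diagonal, $c_1$ on the superdiagonal and $c_{-1}$ on the subdiagonal; $\mathbf{A}$ has entries $\mathbf{A}_{ij}=w^{(\alpha)}_{i-j+1}$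 if $i-j+1\ge0$ and $0$ otherwise, where, with $g_k^{(\alpha)}=(-1)^k\binom{\alpha}{k}$, $$w_0^{(\alpha)}=d_1g_0^{(\alpha)},\quad w_1^{(\alpha)}=d_0g_0^{(\alpha)}+d_1g_1^{(\alpha)},\quad w_k^{(\alpha)}=d_{-1}g_{k-2}^{(\alpha)}+d_0g_{k-1}^{(\alpha)}+d_1g_k^{(\alpha)}\ (k\ge2).$$ A real matrix $\mathbf{B}$ is positive (negative) definite if $\mathbf{x}^T\mathbf{B}\mathbf{x}>0$ ($<0$) for all real $\mathbf{x}\neq\mathbf{0}$. Unconditionally stable means: for all $\tau>0$ and $h>0$, every eigenvalue of the iteration matrix $(\mathbf{T}-\widetilde{\mathbf{A}})^{-1}(\mathbf{T}+\widetilde{\mathbf{A}})$, where $\widetilde{\mathbf{A}}=\frac{\tau}{2h^{\alpha}}(K_1\mathbf{A}+K_2\mathbf{A}^{T})$, has modulus less than one. *)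

(* Defs.v *)
From mathcomp Require Import all_boot all_order all_algebra.
From mathcomp Require Import complex.
From mathcomp Require Import reals exp.

Set Implicit Arguments.
Unset Strict Implicit.
Unset Printing Implicit Defensive.

Import Order.TTheory GRing.Theory Num.Theory.
Local Open Scope ring_scope.

Definition posdefmx (R : realType) (n : nat) (B : 'M[R]_n) : Prop :=
  forall x : 'cV[R]_n, x != 0 -> 0 < (x^T *m B *m x) 0 0.

Definition negdefmx (R : realType) (n : nat) (B : 'M[R]_n) : Prop :=
  forall x : 'cV[R]_n, x != 0 -> (x^T *m B *m x) 0 0 < 0.

Definition gbinom (R : realType) (alpha : R) (k : nat) : R :=
  (\prod_(i < k) (alpha - i%:R)) / k`!%:R.

Definition g (R : realType) (alpha : R) (k : nat) : R :=
  (-1) ^+ k * gbinom alpha k.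

Definition w (R : realType) (alpha dm1 d0 d1 : R) (k : nat) : R :=
  match k with
  | 0%N => d1 * g alpha 0
  | 1%N => d0 * g alpha 0 + d1 * g alpha 1
  | j.+2 => dm1 * g alpha j + d0 * g alpha j.+1 + d1 * g alpha j.+2
  end.

Definition Tmx (R : realType) (n : nat) (cm1 c0 c1 : R) : 'M[R]_n :=
  \matrix_(i < n, j < n)
    if (i == j :> nat) then c0
    else if (j == i.+1 :> nat) then c1
    else if (i == j.+1 :> nat) then cm1
    else 0.

(* The subtraction on nat is exact under the guard [j <= i.+1]. *)
Definition Amx (R : realType) (n : nat) (alpha dm1 d0 d1 : R) : 'M[R]_n :=
  \matrix_(i < n, j < n)
    if (j <= i.+1)%N then w alpha dm1 d0 d1 (i.+1 - j) else 0.

Definition Atilde (R : realType) (n : nat) (alpha K1 K2 tau h : R)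
    (A : 'M[R]_n) : 'M[R]_n :=
  (tau / (2 * h `^ alpha)) *: (K1 *: A + K2 *: A^T).

Record two_level_scheme (R : realType) (n : nat) := TwoLevelScheme {
  new_mx : 'M[R]_n;
  old_mx : 'M[R]_n;
  load : nat -> 'cV[R]_n
}.

(* The equation that a solution [U] of the scheme satisfies at every step. *)
Definition scheme_solution (R : realType) (n : nat)
    (S : two_level_scheme R n) (U : nat -> 'cV[R]_n) : Prop :=
  forall k, new_mx S *m U k.+1 = old_mx S *m U k + load S k.

Definition iteration_mx (R : realType) (n : nat)
    (S : two_level_scheme R n) : 'M[R]_n :=
  invmx (new_mx S) *m old_mx S.

Definition cn_scheme (R : realType) (n : nat)
    (alpha K1 K2 cm1 c0 c1 dm1 d0 d1 tau h : R)
    (F H : nat -> 'cV[R]_n) : two_level_scheme R n :=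
  let T := Tmx n cm1 c0 c1 in
  let At := Atilde alpha K1 K2 tau h (Amx n alpha dm1 d0 d1) in
  TwoLevelScheme (T - At) (T + At) (fun k => tau *: F k + H k).

(* Invertibility is required explicitly because [invmx B] is [B] itself when
   [B] is singular.  The iteration matrix is mapped to R[i] so that its complex
   eigenvalues are taken into account; [eigenvalue] refers to row eigenvectors,
   which gives the same spectrum. *)
Definition unconditionally_stable (R : realType) (n : nat)
    (S : R -> R -> two_level_scheme R n) : Prop :=
  forall tau h : R, 0 < tau -> 0 < h ->
    new_mx (S tau h) \in unitmx /\
    forall lambda : R[i],
      eigenvalue (map_mx (real_complex R) (iteration_mx (S tau h))) lambda ->
      `|lambda| < 1.

(* Main.v *)
Require Import Defs.
From mathcomp Require Import all_boot all_order all_algebra.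
From mathcomp Require Import complex.
From mathcomp Require Import reals exp.
From mathcomp Require Import ring lra.

Set Implicit Arguments.
Unset Strict Implicit.
Unset Printing Implicit Defensive.

Import Order.TTheory GRing.Theory Num.Theory.
Local Open Scope ring_scope.

(** The iteration matrix is a Cayley transform: with T symmetric and B the
    scaled conic combination of A and A^T, it is (T - B)^-1 (T + B).  A row
    eigenvector for lambda yields a nonzero complex row y with
    y (T + B) = lambda y (T - B); pairing with the conjugate of y turns this
    into the scalar equation t + b = lambda (t - b), where t and b are the
    values at y of the sesquilinear forms of T and B.  As T is symmetric and
    positive definite, t is a positive real; as B is negative definite, b has
    negative real part, whatever its imaginary part is
    ([sesquilinear_value]).  So t - b is further from the origin than t + b
    ([norm_add_lt_sub]), and |lambda| < 1 ([cayley_eigenvalue_lt1]).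

    It remains to see that B is negative definite: A and A^T have the same
    quadratic form, so every nonzero conic combination of them inherits the
    sign of A ([negdefmx_Atilde]).  The factor tau / (2 h^alpha) enters only
    through its positivity, which is why no relation between tau and h has to
    be imposed. *)

Lemma quad_trmx (R : realType) n (B : 'M[R]_n) (x : 'cV[R]_n) :
  (x^T *m B^T *m x) 0 0 = (x^T *m B *m x) 0 0.
Proof.
have -> : x^T *m B^T *m x = (x^T *m B *m x)^T by rewrite !trmx_mul trmxK mulmxA.
by rewrite mxE.
Qed.

Lemma negdefmx_Atilde (R : realType) n (alpha K1 K2 tau h : R) (A : 'M[R]_n) :
  0 <= K1 -> 0 <= K2 -> K1 ^+ 2 + K2 ^+ 2 != 0 -> 0 < tau -> 0 < h ->
  negdefmx A -> negdefmx (Atilde alpha K1 K2 tau h A).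
Proof.
move=> K1ge0 K2ge0 K12 tau_gt0 h_gt0 Aneg x x0.
have -> : (x^T *m Atilde alpha K1 K2 tau h A *m x) 0 0 =
          tau / (2 * h `^ alpha) * ((K1 + K2) * (x^T *m A *m x) 0 0).
  rewrite /Atilde -scalemxAr -scalemxAl mxE; congr (_ * _).
  rewrite mulmxDr mulmxDl mxE -!scalemxAr -!scalemxAl.
  by rewrite mxE [X in _ + X]mxE quad_trmx mulrDl.
have c_gt0 : 0 < tau / (2 * h `^ alpha).
  by rewrite divr_gt0 // mulr_gt0 // powR_gt0.
have K_gt0 : 0 < K1 + K2.
  rewrite lt0r addr_ge0 // andbT; apply: contraNneq K12 => /eqP.
  by rewrite paddr_eq0 // => /andP[/eqP-> /eqP->]; rewrite expr0n addr0.
by rewrite !pmulr_rlt0 // Aneg.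
Qed.

Lemma posdefmx_oppr (R : realType) n (B : 'M[R]_n) :
  negdefmx B -> posdefmx (- B).
Proof. by move=> Bneg x x0; rewrite mulmxN mulNmx mxE oppr_gt0 Bneg. Qed.

Lemma posdefmxD (R : realType) n (A B : 'M[R]_n) :
  posdefmx A -> posdefmx B -> posdefmx (A + B).
Proof.
move=> Apos Bpos x x0; rewrite mulmxDr mulmxDl mxE.
by rewrite addr_gt0 ?Apos ?Bpos.
Qed.

Lemma posdefmx_row_gt0 (R : realType) n (B : 'M[R]_n) (p : 'rV[R]_n) :
  posdefmx B -> p != 0 -> 0 < (p *m B *m p^T) 0 0.
Proof.
move=> Bpos p0; have := Bpos p^T; rewrite trmxK; apply.
by rewrite -trmx0 (inj_eq trmx_inj).
Qed.

Lemma posdefmx_row_ge0 (R : realType) n (B : 'M[R]_n) (p : 'rV[R]_n) :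
  posdefmx B -> 0 <= (p *m B *m p^T) 0 0.
Proof.
move=> Bpos; have [->|p0] := eqVneq p 0; first by rewrite !mul0mx mxE.
exact/ltW/posdefmx_row_gt0.
Qed.

(** The real part of [sesquilinear_value] is positive on nonzero complex rows
    p + i q. *)
Lemma posdefmx_rowD_gt0 (R : realType) n (B : 'M[R]_n) (p q : 'rV[R]_n) :
  posdefmx B -> (p != 0) || (q != 0) ->
  0 < (p *m B *m p^T) 0 0 + (q *m B *m q^T) 0 0.
Proof.
move=> Bpos /orP[z0|z0].
  by rewrite ltr_pwDl ?posdefmx_row_gt0 ?posdefmx_row_ge0.
by rewrite ltr_wpDl ?posdefmx_row_gt0 ?posdefmx_row_ge0.
Qed.

Lemma posdefmx_unit (R : realType) n (B : 'M[R]_n) :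
  posdefmx B -> B \in unitmx.
Proof.
move=> Bpos; rewrite -row_free_unit -kermx_eq0; apply: contraT => /rowV0Pn[v].
move=> /sub_kermxP vB v0; have := posdefmx_row_gt0 Bpos v0.
by rewrite vB mul0mx mxE ltxx.
Qed.

Local Notation rc := (map_mx (real_complex _)).

(** The value y M y^* at y = p + i q of the sesquilinear form of a real matrix.
    Its real part splits into real quadratic forms, to which definiteness over
    the reals applies; its imaginary part vanishes when M is symmetric. *)
Lemma sesquilinear_value (R : realType) n (M : 'M[R]_n) (p q : 'rV[R]_n) :
  ((rc p + 'i%C *: rc q) *m rc M *m (rc p - 'i%C *: rc q)^T) 0 0 =
  (((p *m M *m p^T) 0 0 + (q *m M *m q^T) 0 0) +i*
   ((q *m M *m p^T) 0 0 - (p *m M *m q^T) 0 0))%C.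
Proof.
have E (u v : 'rV[R]_n) :
    (rc u *m rc M *m (rc v)^T) 0 0 = ((u *m M *m v^T) 0 0)%:C%C.
  by rewrite map_trmx -!map_mxM mxE.
have -> : (rc p - 'i%C *: rc q)^T = (rc p)^T - 'i%C *: (rc q)^T.
  by rewrite linearB linearZ.
have entryD (X Y : 'M[R[i]]_1) : (X + Y) 0 0 = X 0 0 + Y 0 0 by rewrite mxE.
have entryN (X : 'M[R[i]]_1) : (- X) 0 0 = - X 0 0 by rewrite mxE.
have entryZ a (X : 'M[R[i]]_1) : (a *: X) 0 0 = a * X 0 0 by rewrite mxE.
rewrite !mulmxDl !mulmxDr !mulmxN -!scalemxAr -!scalemxAl.
rewrite !(entryD, entryN, entryZ, E).
by apply/eqP; rewrite eq_complex /=; apply/andP; split; apply/eqP; ring.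
Qed.

(** The points equidistant from t and - t are those of the imaginary axis, and b
    lies on the side of - t. *)
Lemma norm_add_lt_sub (R : realType) (t : R) (b : R[i]) :
  0 < t -> complex.Re b < 0 -> `|t%:C%C + b| < `|t%:C%C - b|.
Proof.
case: b => c e /= t0 c0.
rewrite -(ltr_pXn2r (n := 2)) ?nnegrE // !sqr_normc ltcE /=.
have tc : t * c < 0 by rewrite pmulr_rlt0.
by apply/andP; split; [apply/eqP; ring | nra].
Qed.

Lemma cayley_eigenvalue_lt1 (R : realType) n (T B : 'M[R]_n) (lambda : R[i]) :
  T^T = T -> posdefmx T -> negdefmx B ->
  eigenvalue (rc (invmx (T - B) *m (T + B))) lambda ->
  `|lambda| < 1.
Proof.
move=> Tsym Tpos Bneg /eigenvalueP[v]; rewrite map_mxM map_invmx => vE v0.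
have NBpos := posdefmx_oppr Bneg.
have Punit : rc (T - B) \in unitmx.
  by rewrite map_unitmx; apply/posdefmx_unit/posdefmxD.
pose y := v *m invmx (rc (T - B)).
have yE : y *m rc (T + B) = lambda *: (y *m rc (T - B)).
  by rewrite /y mulmxKV // -mulmxA vE.
have y0 : y != 0.
  by apply: contraNneq v0 => y0; rewrite -(mulmxKV Punit v) -/y y0 mul0mx.
pose p : 'rV[R]_n := map_mx (@complex.Re R) y.
pose q : 'rV[R]_n := map_mx (@complex.Im R) y.
have ypq : y = rc p + 'i%C *: rc q.
  by apply/rowP => j; rewrite !mxE; exact: complexE.
have pq0 : (p != 0) || (q != 0).
  rewrite -negb_and; apply: contra y0 => /andP[/eqP p0 /eqP q0].
  by rewrite ypq p0 q0 !map_mx0 scaler0 addr0.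
pose ys := (rc p - 'i%C *: rc q)^T.
pose form (M : 'M[R]_n) := (y *m rc M *m ys) 0 0.
have formE M : form M = (((p *m M *m p^T) 0 0 + (q *m M *m q^T) 0 0) +i*
   ((q *m M *m p^T) 0 0 - (p *m M *m q^T) 0 0))%C.
  by rewrite /form ypq sesquilinear_value.
have formD M N : form (M + N) = form M + form N.
  by rewrite /form map_mxD mulmxDr mulmxDl mxE.
have formN M : form (- M) = - form M.
  by rewrite /form map_mxN mulmxN mulNmx mxE.
have scalarE : form T + form B = lambda * (form T - form B).
  by rewrite -formN -!formD /form yE -scalemxAl mxE.
have formT : form T = (complex.Re (form T))%:C%C.
  rewrite formE; congr (_ +i* _)%C => /=.
  (* The two cross terms are transposes of each other. *)
  suff -> : q *m T *m p^T = (p *m T *m q^T)^T by rewrite mxE subrr.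
  by rewrite !trmx_mul trmxK Tsym mulmxA.
have t_gt0 : 0 < complex.Re (form T) by rewrite formE; apply: posdefmx_rowD_gt0.
have b_lt0 : complex.Re (form B) < 0.
  have : 0 < complex.Re (form (- B)) by rewrite formE; apply: posdefmx_rowD_gt0.
  by rewrite formN; case: (form B) => ? ? /=; rewrite oppr_gt0.
have := norm_add_lt_sub t_gt0 b_lt0; rewrite -formT scalarE normrM => lt_norm.
have d_gt0 : 0 < `|form T - form B|.
  by apply: le_lt_trans lt_norm; rewrite mulr_ge0.
by rewrite -(ltr_pM2r d_gt0) mul1r.
Qed.

Theorem theorem4 (R : realType) (N : nat) (hN : (0 < N)%N)
    (alpha : R) (halpha1 : 1 < alpha) (halpha2 : alpha <= 2)
    (K1 K2 : R) (hK1 : 0 <= K1) (hK2 : 0 <= K2)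
    (hK : K1 ^+ 2 + K2 ^+ 2 != 0)
    (cm1 c0 c1 dm1 d0 d1 : R)
    (hTsym : (Tmx N.-1 cm1 c0 c1)^T = Tmx N.-1 cm1 c0 c1)
    (hTpos : posdefmx (Tmx N.-1 cm1 c0 c1))
    (hAneg : negdefmx (Amx N.-1 alpha dm1 d0 d1))
    (F H : R -> R -> nat -> 'cV[R]_N.-1) :
  unconditionally_stable (fun tau h : R =>
    cn_scheme alpha K1 K2 cm1 c0 c1 dm1 d0 d1 tau h (F tau h) (H tau h)).
Proof.
move=> tau h tau_gt0 h_gt0; rewrite /iteration_mx /=.
have Bneg := negdefmx_Atilde alpha hK1 hK2 hK tau_gt0 h_gt0 hAneg.
split; first exact/posdefmx_unit/posdefmxD/posdefmx_oppr.
by move=> lambda; apply: cayley_eigenvalue_lt1.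
Qed.
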